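(* If $\mathsf{B}$ is a univalent bicategory, then the bicategory $\mathsf{M}(\mathsf{B})$ of monads internal to $\mathsf{B}$ is univalent.
   Context: We work in Martin-Löf type theory with function extensionality (univalent foundations). A bicategory $\mathsf{B}$ has a type $\mathsf{B}_0$ of objects, types $\mathsf{B}_1(a,b)$ of 1-cells $a\to b$, and sets $\mathsf{B}_2(f,g)$ of 2-cells $f\Rightarrow g$ (no truncation on objects or 1-cells), with identities, composition $f\cdot g$ of 1-cells (diagrammatic order), vertical composition $\bullet$, whiskerings $f\vartriangleleft\theta$ and $\theta\vartriangleright g$, invertible unitors $\lambda(f):\mathrm{id}_1\cdot f\Rightarrow f$, $\rho(f):f\cdot\mathrm{id}_1\Rightarrow f$ and associators $\alpha(f,g,h):f\cdot(g\cdot h)\Rightarrow(f\cdot g)\cdot h$, satisfying the usual axioms. An invertible 2-cell is a 2-cell with a two-sided inverse for $\bullet$. An adjoint equivalence $a\simeq b$ is a 1-cell $f:a\to b$ with $g:b\to a$ and invertible 2-cells $\mathrm{id}_1(a)\Rightarrow f\cdot g$, $g\cdot f\Rightarrow\mathrm{id}_1(b)$ satisfying the two triangle identities. $\mathsf{B}$ is locally univalent if for all parallel 1-cells the canonical map from $(f=g)$ to the type of invertible 2-cells $f\Rightarrow g$ (sending $\mathsf{refl}$ to the identity) is an equivalence; globally univalent if for all objects the canonical map from $(a=b)$ to the type of adjoint equivalences $a\simeq b$ (sending $\mathsf{refl}$ to the identity) is an equivalence; univalent if both. The bicategory $\mathsf{M}(\mathsf{B})$ of monads internal to $\mathsf{B}$.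 Objects: $(a,m_a,\eta_a,\mu_a)$ with $a:\mathsf{B}_0$, a 1-cell $m_a:a\to a$, and 2-cells $\eta_a:\mathrm{id}_1(a)\Rightarrow m_a$, $\mu_a:m_a\cdot m_a\Rightarrow m_a$ satisfying $(m_a\vartriangleleft\eta_a)\bullet\mu_a=\rho(m_a)$, $(\eta_a\vartriangleright m_a)\bullet\mu_a=\lambda(m_a)$ and $(m_a\vartriangleleft\mu_a)\bullet\mu_a=\alpha(m_a,m_a,m_a)\bullet(\mu_a\vartriangleright m_a)\bullet\mu_a$. 1-cells from $(a,m_a,\eta_a,\mu_a)$ to $(b,m_b,\eta_b,\mu_b)$: a 1-cell $f:a\to b$ with an invertible 2-cell $n_f:m_a\cdot f\Rightarrow f\cdot m_b$ such that $(\eta_a\vartriangleright f)\bullet n_f=\lambda(f)\bullet\rho(f)^{-1}\bullet(f\vartriangleleft\eta_b)$ and $(\mu_a\vartriangleright f)\bullet n_f=\alpha^{-1}\bullet(m_a\vartriangleleft n_f)\bullet\alpha\bullet(n_f\vartriangleright m_b)\bullet\alpha^{-1}\bullet(f\vartriangleleft\mu_b)$. 2-cells $(f,n_f)\Rightarrow(g,n_g)$: 2-cells $x:f\Rightarrow g$ of $\mathsf{B}$ with $n_f\bullet(x\vartriangleright m_b)=(m_a\vartriangleleft x)\bullet n_g$. Identities, compositions and whiskerings are inherited from $\mathsf{B}$, with the evident pasted structure 2-cells. *)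

(* Defs.v *)
From Corelib Require Import ssreflect.

Set Implicit Arguments.
Unset Strict Implicit.

(* Identity types are rendered by [eq]: it has the rules of the Martin-Löf
   identity type (dependent elimination into [Type] included), and neither
   proof irrelevance nor uniqueness of identity proofs is assumed here. *)

Definition isaset (T : Type) : Type := forall (x y : T) (p q : x = y), p = q.

Definition iscontr (T : Type) : Type := {c : T & forall t : T, t = c}.

Definition isequiv (S T : Type) (h : S -> T) : Type :=
  forall t : T, iscontr {s : S & h s = t}.

Declare Scope bicat_scope.
Delimit Scope bicat_scope with bicat.
Local Open Scope bicat_scope.

Reserved Notation "a --> b" (at level 55).
Reserved Notation "f ==> g" (at level 60).
Reserved Notation "f · g" (at level 40, left associativity).
Reserved Notation "x • y" (at level 45, left associativity).
Reserved Notation "f ◃ x" (at level 42, left associativity).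
Reserved Notation "x ▹ f" (at level 42, left associativity).

(* Compositions of 1-cells and of 2-cells are written in diagrammatic order. *)
Record bicat_data : Type := BicatData {
  ob :> Type;
  hom : ob -> ob -> Type
    where "a --> b" := (hom a b);
  cell : forall a b : ob, a --> b -> a --> b -> Type
    where "f ==> g" := (cell f g);
  id1 : forall a : ob, a --> a;
  comp1 : forall a b c : ob, a --> b -> b --> c -> a --> c
    where "f · g" := (comp1 f g);
  id2 : forall (a b : ob) (f : a --> b), f ==> f;
  vcomp : forall (a b : ob) (f g h : a --> b), f ==> g -> g ==> h -> f ==> h;
  lwhisker : forall (a b c : ob) (f : a --> b) (g h : b --> c),
    g ==> h -> f · g ==> f · h;
  rwhisker : forall (a b c : ob) (f g : a --> b) (h : b --> c),
    f ==> g -> f · h ==> g · h;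
  lunitor : forall (a b : ob) (f : a --> b), id1 a · f ==> f;
  linvunitor : forall (a b : ob) (f : a --> b), f ==> id1 a · f;
  runitor : forall (a b : ob) (f : a --> b), f · id1 b ==> f;
  rinvunitor : forall (a b : ob) (f : a --> b), f ==> f · id1 b;
  lassoc : forall (a b c d : ob) (f : a --> b) (g : b --> c) (h : c --> d),
    f · (g · h) ==> (f · g) · h;
  rassoc : forall (a b c d : ob) (f : a --> b) (g : b --> c) (h : c --> d),
    (f · g) · h ==> f · (g · h)
}.

Arguments id1 {_} _.
Arguments id2 {_ _ _} _.
Arguments lwhisker {_ _ _ _} _ {_ _} _.
Arguments rwhisker {_ _ _ _ _ _} _ _.
Arguments lunitor {_ _ _} _.
Arguments linvunitor {_ _ _} _.
Arguments runitor {_ _ _} _.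
Arguments rinvunitor {_ _ _} _.
Arguments lassoc {_ _ _ _ _} _ _ _.
Arguments rassoc {_ _ _ _ _} _ _ _.

Notation "a --> b" := (hom a b) : bicat_scope.
Notation "f ==> g" := (cell f g) : bicat_scope.
Notation "f · g" := (comp1 f g) : bicat_scope.
Notation "x • y" := (vcomp x y) : bicat_scope.
Notation "f ◃ x" := (lwhisker f x) : bicat_scope.
Notation "x ▹ f" := (rwhisker f x) : bicat_scope.

Record bicat_laws (B : bicat_data) : Prop := BicatLaws {
  id2_left_law : forall (a b : B) (f g : a --> b) (x : f ==> g),
    id2 f • x = x;
  id2_right_law : forall (a b : B) (f g : a --> b) (x : f ==> g),
    x • id2 g = x;
  vassocr_law : forall (a b : B) (f g h k : a --> b)
      (x : f ==> g) (y : g ==> h) (z : h ==> k),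
    x • (y • z) = x • y • z;
  lwhisker_id2_law : forall (a b c : B) (f : a --> b) (g : b --> c),
    f ◃ id2 g = id2 (f · g);
  rwhisker_id2_law : forall (a b c : B) (f : a --> b) (g : b --> c),
    id2 f ▹ g = id2 (f · g);
  lwhisker_vcomp_law : forall (a b c : B) (f : a --> b) (g h i : b --> c)
      (x : g ==> h) (y : h ==> i),
    f ◃ (x • y) = (f ◃ x) • (f ◃ y);
  rwhisker_vcomp_law : forall (a b c : B) (f g h : a --> b) (i : b --> c)
      (x : f ==> g) (y : g ==> h),
    (x • y) ▹ i = (x ▹ i) • (y ▹ i);
  lunitor_natural_law : forall (a b : B) (f g : a --> b) (x : f ==> g),
    (id1 a ◃ x) • lunitor g = lunitor f • x;
  runitor_natural_law : forall (a b : B) (f g : a --> b) (x : f ==> g),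
    (x ▹ id1 b) • runitor g = runitor f • x;
  lwhisker_lwhisker_law : forall (a b c d : B) (f : a --> b) (g : b --> c)
      (h i : c --> d) (x : h ==> i),
    (f ◃ (g ◃ x)) • lassoc f g i = lassoc f g h • (f · g ◃ x);
  rwhisker_lwhisker_law : forall (a b c d : B) (f : a --> b) (g h : b --> c)
      (i : c --> d) (x : g ==> h),
    (f ◃ (x ▹ i)) • lassoc f h i = lassoc f g i • ((f ◃ x) ▹ i);
  rwhisker_rwhisker_law : forall (a b c d : B) (f g : a --> b) (h : b --> c)
      (i : c --> d) (x : f ==> g),
    (x ▹ h · i) • lassoc g h i = lassoc f h i • ((x ▹ h) ▹ i);
  vcomp_whisker_law : forall (a b c : B) (f g : a --> b) (h i : b --> c)
      (x : f ==> g) (y : h ==> i),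
    (x ▹ h) • (g ◃ y) = (f ◃ y) • (x ▹ i);
  lunitor_linvunitor_law : forall (a b : B) (f : a --> b),
    lunitor f • linvunitor f = id2 (id1 a · f);
  linvunitor_lunitor_law : forall (a b : B) (f : a --> b),
    linvunitor f • lunitor f = id2 f;
  runitor_rinvunitor_law : forall (a b : B) (f : a --> b),
    runitor f • rinvunitor f = id2 (f · id1 b);
  rinvunitor_runitor_law : forall (a b : B) (f : a --> b),
    rinvunitor f • runitor f = id2 f;
  lassoc_rassoc_law : forall (a b c d : B) (f : a --> b) (g : b --> c)
      (h : c --> d),
    lassoc f g h • rassoc f g h = id2 (f · (g · h));
  rassoc_lassoc_law : forall (a b c d : B) (f : a --> b) (g : b --> c)
      (h : c --> d),
    rassoc f g h • lassoc f g h = id2 ((f · g) · h);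
  triangle_law : forall (a b c : B) (f : a --> b) (g : b --> c),
    lassoc f (id1 b) g • (runitor f ▹ g) = f ◃ lunitor g;
  pentagon_law : forall (a b c d e : B) (f : a --> b) (g : b --> c)
      (h : c --> d) (i : d --> e),
    (f ◃ lassoc g h i) • lassoc f (g · h) i • (lassoc f g h ▹ i)
    = lassoc f g (h · i) • lassoc (f · g) h i
}.

Record bicat : Type := Bicat {
  bicat_data_of :> bicat_data;
  bicat_laws_of : bicat_laws bicat_data_of;
  cell_isaset : forall (a b : bicat_data_of) (f g : a --> b), isaset (f ==> g)
}.

Section Accessors.
Variable B : bicat.
Definition id2_left := id2_left_law (bicat_laws_of B).
Definition id2_right := id2_right_law (bicat_laws_of B).
Definition vassocr := vassocr_law (bicat_laws_of B).
Definition lwhisker_id2 := lwhisker_id2_law (bicat_laws_of B).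
Definition rwhisker_id2 := rwhisker_id2_law (bicat_laws_of B).
Definition lwhisker_vcomp := lwhisker_vcomp_law (bicat_laws_of B).
Definition rwhisker_vcomp := rwhisker_vcomp_law (bicat_laws_of B).
Definition lunitor_natural := lunitor_natural_law (bicat_laws_of B).
Definition runitor_natural := runitor_natural_law (bicat_laws_of B).
Definition lwhisker_lwhisker := lwhisker_lwhisker_law (bicat_laws_of B).
Definition rwhisker_lwhisker := rwhisker_lwhisker_law (bicat_laws_of B).
Definition rwhisker_rwhisker := rwhisker_rwhisker_law (bicat_laws_of B).
Definition vcomp_whisker := vcomp_whisker_law (bicat_laws_of B).
Definition lunitor_linvunitor := lunitor_linvunitor_law (bicat_laws_of B).
Definition linvunitor_lunitor := linvunitor_lunitor_law (bicat_laws_of B).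
Definition runitor_rinvunitor := runitor_rinvunitor_law (bicat_laws_of B).
Definition rinvunitor_runitor := rinvunitor_runitor_law (bicat_laws_of B).
Definition lassoc_rassoc := lassoc_rassoc_law (bicat_laws_of B).
Definition rassoc_lassoc := rassoc_lassoc_law (bicat_laws_of B).
Definition triangle := triangle_law (bicat_laws_of B).
Definition pentagon := pentagon_law (bicat_laws_of B).
End Accessors.

Record is_invertible (B : bicat) (a b : B) (f g : a --> b) (x : f ==> g)
    : Type := IsInvertible {
  inv_cell : g ==> f;
  inv_cell_right : x • inv_cell = id2 f;
  inv_cell_left : inv_cell • x = id2 g
}.

Record inv2cell (B : bicat) (a b : B) (f g : a --> b) : Type := Inv2cell {
  inv2cell_cell :> f ==> g;
  inv2cell_invertible : is_invertible inv2cell_cell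
}.

Section Coherence.
Variable B : bicat.
Implicit Types a b c d e : B.

Lemma id2_invertible a b (f : a --> b) : is_invertible (id2 f).
Proof. by exists (id2 f); rewrite id2_left. Defined.

Lemma inverse_invertible a b (f g : a --> b) (x : f ==> g)
  (hx : is_invertible x) : is_invertible (inv_cell hx).
Proof. exists x; [exact: inv_cell_left | exact: inv_cell_right]. Defined.

Lemma vcomp_invertible a b (f g h : a --> b) (x : f ==> g) (y : g ==> h) :
  is_invertible x -> is_invertible y -> is_invertible (x • y).
Proof.
move=> hx hy; exists (inv_cell hy • inv_cell hx); rewrite vassocr.
- by rewrite -(vassocr x) inv_cell_right id2_right inv_cell_right.
- by rewrite -(vassocr (inv_cell hy)) inv_cell_left id2_right inv_cell_left.
Defined.

Lemma lwhisker_invertible a b c (f : a --> b) (g h : b --> c) (x : g ==> h) :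
  is_invertible x -> is_invertible (f ◃ x).
Proof.
move=> hx; exists (f ◃ inv_cell hx); rewrite -lwhisker_vcomp.
- by rewrite inv_cell_right lwhisker_id2.
- by rewrite inv_cell_left lwhisker_id2.
Defined.

Lemma rwhisker_invertible a b c (f g : a --> b) (h : b --> c) (x : f ==> g) :
  is_invertible x -> is_invertible (x ▹ h).
Proof.
move=> hx; exists (inv_cell hx ▹ h); rewrite -rwhisker_vcomp.
- by rewrite inv_cell_right rwhisker_id2.
- by rewrite inv_cell_left rwhisker_id2.
Defined.

Lemma lunitor_invertible a b (f : a --> b) : is_invertible (lunitor f).
Proof.
exists (linvunitor f); [exact: lunitor_linvunitor | exact: linvunitor_lunitor].
Defined.

Lemma linvunitor_invertible a b (f : a --> b) : is_invertible (linvunitor f).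
Proof. exact: (inverse_invertible (lunitor_invertible f)). Defined.

Lemma runitor_invertible a b (f : a --> b) : is_invertible (runitor f).
Proof.
exists (rinvunitor f); [exact: runitor_rinvunitor | exact: rinvunitor_runitor].
Defined.

Lemma lassoc_invertible a b c d (f : a --> b) (g : b --> c) (h : c --> d) :
  is_invertible (lassoc f g h).
Proof.
exists (rassoc f g h); [exact: lassoc_rassoc | exact: rassoc_lassoc].
Defined.

Lemma rassoc_invertible a b c d (f : a --> b) (g : b --> c) (h : c --> d) :
  is_invertible (rassoc f g h).
Proof. exact: (inverse_invertible (lassoc_invertible f g h)). Defined.

Lemma vcomp_lcancel a b (f g h : a --> b) (x : f ==> g) (y z : g ==> h) :
  is_invertible x -> x • y = x • z -> y = z.
Proof.
move=> hx e; rewrite -(id2_left y) -(id2_left z) -(inv_cell_left hx).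
by rewrite -!vassocr e.
Qed.

Lemma vcomp_rcancel a b (f g h : a --> b) (x : g ==> h) (y z : f ==> g) :
  is_invertible x -> y • x = z • x -> y = z.
Proof.
move=> hx e; rewrite -(id2_right y) -(id2_right z) -(inv_cell_right hx).
by rewrite !vassocr e.
Qed.

Lemma pre2 a b (f g h i : a --> b) (x : f ==> g) (y : g ==> h) (z : f ==> h) :
  x • y = z -> forall k : i ==> f, k • x • y = k • z.
Proof. by move=> e k; rewrite -vassocr e. Qed.

Lemma pre3 a b (f g h i j : a --> b) (x : f ==> g) (y : g ==> h) (w : h ==> i)
  (z : f ==> i) : x • y • w = z -> forall k : j ==> f, k • x • y • w = k • z.
Proof. by move=> e k; rewrite -(vassocr k) -(vassocr k) e. Qed.

Lemma id_lwhisker_inj a b (f g : a --> b) (x y : f ==> g) :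
  id1 a ◃ x = id1 a ◃ y -> x = y.
Proof.
move=> e; apply: (vcomp_lcancel (lunitor_invertible f)).
by rewrite -!lunitor_natural e.
Qed.

Lemma id_rwhisker_inj a b (f g : a --> b) (x y : f ==> g) :
  x ▹ id1 b = y ▹ id1 b -> x = y.
Proof.
move=> e; apply: (vcomp_lcancel (runitor_invertible f)).
by rewrite -!runitor_natural e.
Qed.

Lemma lunitor_triangle a b c (f : a --> b) (g : b --> c) :
  lassoc (id1 a) f g • (lunitor f ▹ g) = lunitor (f · g).
Proof.
apply: id_lwhisker_inj; rewrite lwhisker_vcomp.
apply: (vcomp_rcancel (lassoc_invertible _ _ _)).
rewrite (pre2 (rwhisker_lwhisker _ _ _)) -(triangle (id1 a) f) rwhisker_vcomp.
rewrite !vassocr pentagon -(triangle (id1 a) (f · g)).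
by rewrite -!vassocr rwhisker_rwhisker.
Qed.

Lemma runitor_triangle a b c (f : a --> b) (g : b --> c) :
  lassoc f g (id1 c) • runitor (f · g) = f ◃ runitor g.
Proof.
symmetry; apply: id_rwhisker_inj; rewrite rwhisker_vcomp.
apply: (@vcomp_lcancel _ _ _ _ _
  ((f ◃ lassoc g (id1 c) (id1 c)) • lassoc f (g · id1 c) (id1 c))).
  apply: vcomp_invertible; first exact/lwhisker_invertible/lassoc_invertible.
  exact: lassoc_invertible.
rewrite !vassocr pentagon (pre2 (triangle _ _)) -lwhisker_lwhisker.
by rewrite -triangle lwhisker_vcomp -!vassocr rwhisker_lwhisker.
Qed.

Lemma lunitor_id_runitor_id a : lunitor (id1 a) = runitor (id1 a).
Proof.
apply: id_rwhisker_inj.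
apply: (vcomp_lcancel (lassoc_invertible _ _ _)).
rewrite lunitor_triangle triangle.
by apply: (vcomp_rcancel (lunitor_invertible _)); rewrite lunitor_natural.
Qed.

End Coherence.

Section Univalence.
Variable B : bicat.

Definition id_inv2cell (a b : B) (f : a --> b) : inv2cell f f :=
  Inv2cell (id2_invertible f).

Definition eq_to_inv2cell (a b : B) (f g : a --> b) (p : f = g) :
    inv2cell f g :=
  match p with eq_refl => id_inv2cell f end.

Definition locally_univalent : Type :=
  forall (a b : B) (f g : a --> b), isequiv (@eq_to_inv2cell a b f g).

Record adj_equiv (a b : B) : Type := AdjEquiv {
  ae_left :> a --> b;
  ae_right : b --> a;
  ae_unit : inv2cell (id1 a) (ae_left · ae_right);
  ae_counit : inv2cell (ae_right · ae_left) (id1 b);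
  ae_triangle_left :
    linvunitor ae_left • (ae_unit ▹ ae_left)
      • rassoc ae_left ae_right ae_left
      • (ae_left ◃ ae_counit) • runitor ae_left
    = id2 ae_left;
  ae_triangle_right :
    rinvunitor ae_right • (ae_right ◃ ae_unit)
      • lassoc ae_right ae_left ae_right
      • (ae_counit ▹ ae_right) • lunitor ae_right
    = id2 ae_right
}.

Lemma id_triangle_left (a : B) :
  linvunitor (id1 a) • (linvunitor (id1 a) ▹ id1 a)
    • rassoc (id1 a) (id1 a) (id1 a)
    • (id1 a ◃ lunitor (id1 a)) • runitor (id1 a)
  = id2 (id1 a).
Proof.
rewrite -triangle -(lunitor_id_runitor_id a) !vassocr.
rewrite (pre2 (rassoc_lassoc _ _ _)) id2_right.
rewrite (pre2 (eq_sym (rwhisker_vcomp _ _ _))) linvunitor_lunitor rwhisker_id2.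
by rewrite id2_right linvunitor_lunitor.
Qed.

Lemma id_triangle_right (a : B) :
  rinvunitor (id1 a) • (id1 a ◃ linvunitor (id1 a))
    • lassoc (id1 a) (id1 a) (id1 a)
    • (lunitor (id1 a) ▹ id1 a) • lunitor (id1 a)
  = id2 (id1 a).
Proof.
rewrite {1}(lunitor_id_runitor_id a) (pre2 (triangle _ _)).
rewrite (pre2 (eq_sym (lwhisker_vcomp _ _ _))) linvunitor_lunitor lwhisker_id2.
by rewrite id2_right lunitor_id_runitor_id rinvunitor_runitor.
Qed.

Definition id_adj_equiv (a : B) : adj_equiv a a :=
  @AdjEquiv a a (id1 a) (id1 a)
    (Inv2cell (linvunitor_invertible (id1 a)))
    (Inv2cell (lunitor_invertible (id1 a)))
    (id_triangle_left a) (id_triangle_right a).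

Definition eq_to_adj_equiv (a b : B) (p : a = b) : adj_equiv a b :=
  match p with eq_refl => id_adj_equiv a end.

Definition globally_univalent : Type :=
  forall a b : B, isequiv (@eq_to_adj_equiv a b).

End Univalence.

Definition is_univalent (B : bicat) : Type :=
  (locally_univalent B * globally_univalent B)%type.

Record monad (B : bicat) : Type := Monad {
  monad_ob :> B;
  monad_endo : monad_ob --> monad_ob;
  monad_unit : id1 monad_ob ==> monad_endo;
  monad_mult : monad_endo · monad_endo ==> monad_endo;
  monad_unit_right : (monad_endo ◃ monad_unit) • monad_mult
    = runitor monad_endo;
  monad_unit_left : (monad_unit ▹ monad_endo) • monad_mult
    = lunitor monad_endo;
  monad_mult_assoc : (monad_endo ◃ monad_mult) • monad_mult
    = lassoc monad_endo monad_endo monad_endo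
      • (monad_mult ▹ monad_endo) • monad_mult
}.

Arguments monad_endo {B} _.
Arguments monad_unit {B} _.
Arguments monad_mult {B} _.

Record monad_hom (B : bicat) (a b : monad B) : Type := MonadHom {
  mhom :> a --> b;
  mhom_cell : monad_endo a · mhom ==> mhom · monad_endo b;
  mhom_cell_invertible : is_invertible mhom_cell;
  mhom_unit : (monad_unit a ▹ mhom) • mhom_cell
    = lunitor mhom • rinvunitor mhom • (mhom ◃ monad_unit b);
  mhom_mult : (monad_mult a ▹ mhom) • mhom_cell
    = rassoc (monad_endo a) (monad_endo a) mhom
      • (monad_endo a ◃ mhom_cell)
      • lassoc (monad_endo a) mhom (monad_endo b)
      • (mhom_cell ▹ monad_endo b)
      • rassoc mhom (monad_endo b) (monad_endo b)
      • (mhom ◃ monad_mult b)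
}.

Arguments mhom_cell {B a b} _.

Record monad_cell (B : bicat) (a b : monad B) (f g : monad_hom a b) : Type :=
MonadCell {
  mcell :> f ==> g;
  mcell_law : mhom_cell f • (mcell ▹ monad_endo b)
    = (monad_endo a ◃ mcell) • mhom_cell g
}.

Section MonadBicat.
Variable B : bicat.
Implicit Types a b c d : monad B.

Lemma monad_cell_eq a b (f g : monad_hom a b) (x y : monad_cell f g) :
  mcell x = mcell y -> x = y.
Proof.
case: x y => [x hx] [y hy] /= e; case: y / e hy => hy.
by rewrite (cell_isaset hx hy).
Qed.


Lemma monad_cell_isaset a b (f g : monad_hom a b) : isaset (monad_cell f g).
Proof.
pose k (x y : monad_cell f g) (p : x = y) : x = y :=
  monad_cell_eq (f_equal (@mcell B a b f g) p).
have k_const x y (p q : x = y) : k x y p = k x y q.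
  rewrite /k; congr (monad_cell_eq _); exact: cell_isaset.
have k_retract x y (p : x = y) :
    p = eq_trans (eq_sym (k x x eq_refl)) (k x y p).
  by case: y / p; rewrite eq_trans_sym_inv_l.
by move=> x y p q; rewrite (k_retract _ _ p) (k_retract _ _ q) (k_const _ _ p q).
Qed.

Lemma swap_inv (u v : B) (f g h i : u --> v) (x : f ==> g) (y : g ==> i)
  (y' : i ==> g) (z : f ==> h) (w : h ==> i) :
  y • y' = id2 g -> x • y = z • w -> x = z • w • y'.
Proof. by move=> hy <-; rewrite -vassocr hy id2_right. Qed.

Lemma linvunitor_natural (u v : B) (f g : u --> v) (x : f ==> g) :
  x • linvunitor g = linvunitor f • (id1 u ◃ x).
Proof.
apply: (vcomp_lcancel (lunitor_invertible f)).
rewrite !vassocr -lunitor_natural lunitor_linvunitor id2_left.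
by rewrite -vassocr lunitor_linvunitor id2_right.
Qed.

Lemma rinvunitor_natural (u v : B) (f g : u --> v) (x : f ==> g) :
  x • rinvunitor g = rinvunitor f • (x ▹ id1 v).
Proof.
apply: (vcomp_lcancel (runitor_invertible f)).
rewrite !vassocr -runitor_natural runitor_rinvunitor id2_left.
by rewrite -vassocr runitor_rinvunitor id2_right.
Qed.

Section Rassoc.
Variables s t u v : B.

Lemma rassoc_conj (f f' : s --> t) (g g' : t --> u) (h h' : u --> v)
  (x : f · (g · h) ==> f' · (g' · h')) (y : (f · g) · h ==> (f' · g') · h') :
  x • lassoc f' g' h' = lassoc f g h • y ->
  y • rassoc f' g' h' = rassoc f g h • x.
Proof.
move=> e; apply: (vcomp_lcancel (lassoc_invertible f g h)).
by rewrite !vassocr -e lassoc_rassoc id2_left -vassocr lassoc_rassoc id2_right.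
Qed.

Lemma lwhisker_rassoc (f : s --> t) (g : t --> u) (h i : u --> v)
  (x : h ==> i) :
  (f · g ◃ x) • rassoc f g i = rassoc f g h • (f ◃ (g ◃ x)).
Proof. exact/rassoc_conj/lwhisker_lwhisker. Qed.

Lemma mid_whisker_rassoc (f : s --> t) (g h : t --> u) (i : u --> v)
  (x : g ==> h) :
  ((f ◃ x) ▹ i) • rassoc f h i = rassoc f g i • (f ◃ (x ▹ i)).
Proof. exact/rassoc_conj/rwhisker_lwhisker. Qed.

Lemma rwhisker_rassoc (f g : s --> t) (h : t --> u) (i : u --> v)
  (x : f ==> g) :
  ((x ▹ h) ▹ i) • rassoc g h i = rassoc f h i • (x ▹ h · i).
Proof. exact/rassoc_conj/rwhisker_rwhisker. Qed.

End Rassoc.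

Lemma id_monad_hom_unit a :
  (monad_unit a ▹ id1 a) • (runitor (monad_endo a) • linvunitor (monad_endo a))
  = lunitor (id1 a) • rinvunitor (id1 a) • (id1 a ◃ monad_unit a).
Proof.
rewrite lunitor_id_runitor_id runitor_rinvunitor id2_left vassocr.
rewrite runitor_natural -lunitor_id_runitor_id -lunitor_natural.
by rewrite -vassocr lunitor_linvunitor id2_right.
Qed.

Lemma rassoc_runitor (u v w : B) (f : u --> v) (g : v --> w) :
  rassoc f g (id1 w) • (f ◃ runitor g) = runitor (f · g).
Proof. by rewrite -runitor_triangle vassocr rassoc_lassoc id2_left. Qed.

Lemma rassoc_lunitor (u v w : B) (f : u --> v) (g : v --> w) :
  rassoc (id1 u) f g • lunitor (f · g) = lunitor f ▹ g.
Proof. by rewrite -lunitor_triangle vassocr rassoc_lassoc id2_left. Qed.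

Lemma rassoc_triangle (u v w : B) (f : u --> v) (g : v --> w) :
  rassoc f (id1 v) g • (f ◃ lunitor g) = runitor f ▹ g.
Proof. by rewrite -triangle vassocr rassoc_lassoc id2_left. Qed.

Lemma linvunitor_triangle (u v w : B) (f : u --> v) (g : v --> w) :
  (f ◃ linvunitor g) • lassoc f (id1 v) g • (runitor f ▹ g) = id2 _.
Proof.
by rewrite -vassocr triangle -lwhisker_vcomp linvunitor_lunitor lwhisker_id2.
Qed.

Lemma id_monad_hom_mult a (m := monad_endo a) :
  (monad_mult a ▹ id1 a) • (runitor m • linvunitor m)
  = rassoc m m (id1 a) • (m ◃ (runitor m • linvunitor m))
      • lassoc m (id1 a) m • ((runitor m • linvunitor m) ▹ m)
      • rassoc (id1 a) m m • (id1 a ◃ monad_mult a).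
Proof.
rewrite lwhisker_vcomp rwhisker_vcomp !vassocr rassoc_runitor.
rewrite (pre3 (linvunitor_triangle _ _)) id2_right.
apply: (vcomp_rcancel (lunitor_invertible _)).
rewrite (pre2 (linvunitor_lunitor _)) id2_right.
rewrite (pre2 (lunitor_natural _)) vassocr (pre2 (rassoc_lunitor _ _)).
rewrite (pre2 (eq_sym (rwhisker_vcomp _ _ _))) linvunitor_lunitor.
by rewrite rwhisker_id2 id2_right runitor_natural.
Qed.

Definition id_monad_hom a : monad_hom a a :=
  @MonadHom B a a (id1 a)
    (runitor (monad_endo a) • linvunitor (monad_endo a))
    (vcomp_invertible (runitor_invertible _) (linvunitor_invertible _))
    (id_monad_hom_unit a) (id_monad_hom_mult a).

Definition comp_cell a b c (f : monad_hom a b) (g : monad_hom b c) :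
    monad_endo a · (f · g) ==> (f · g) · monad_endo c :=
  lassoc (monad_endo a) f g
    • (mhom_cell f ▹ g)
    • rassoc f (monad_endo b) g
    • (f ◃ mhom_cell g)
    • lassoc f g (monad_endo c).

Lemma comp_cell_invertible a b c (f : monad_hom a b) (g : monad_hom b c) :
  is_invertible (comp_cell f g).
Proof.
do !apply: vcomp_invertible; first exact: lassoc_invertible.
- exact/rwhisker_invertible/mhom_cell_invertible.
- exact: rassoc_invertible.
- exact/lwhisker_invertible/mhom_cell_invertible.
- exact: lassoc_invertible.
Defined.

Lemma comp_monad_hom_unit a b c (f : monad_hom a b) (g : monad_hom b c) :
  (monad_unit a ▹ f · g) • comp_cell f g
  = lunitor (f · g) • rinvunitor (f · g) • (f · g ◃ monad_unit c).
Proof.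
rewrite /comp_cell !vassocr rwhisker_rwhisker.
rewrite (pre2 (eq_sym (rwhisker_vcomp _ _ _))) mhom_unit.
rewrite !rwhisker_vcomp !vassocr lunitor_triangle.
rewrite (pre2 (mid_whisker_rassoc _ _ _)) vassocr.
rewrite (pre2 (eq_sym (lwhisker_vcomp _ _ _))) mhom_unit.
rewrite !lwhisker_vcomp !vassocr (pre2 (rassoc_triangle _ _)).
rewrite (pre2 (eq_sym (rwhisker_vcomp _ _ _))) rinvunitor_runitor.
rewrite rwhisker_id2 id2_right (pre2 (lwhisker_lwhisker _ _ _)) vassocr.
congr (_ • _); rewrite -vassocr; congr (_ • _).
apply: (vcomp_rcancel (runitor_invertible _)).
rewrite -vassocr runitor_triangle -lwhisker_vcomp !rinvunitor_runitor.
by rewrite lwhisker_id2.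
Qed.

Lemma whisker_square (s t u v w z : B) (h : s --> t) (p : t --> u)
  (q : u --> v) (r : t --> w) (n : w --> v) (k : v --> z)
  (x : p · q ==> r · n) :
  lassoc (h · p) q k • (rassoc h p q ▹ k) • ((h ◃ x) ▹ k)
    • (lassoc h r n ▹ k) • rassoc (h · r) n k
  = rassoc h p (q · k) • (h ◃ lassoc p q k) • (h ◃ (x ▹ k))
    • (h ◃ rassoc r n k) • lassoc h r (n · k).
Proof.
apply: (vcomp_rcancel (lassoc_invertible _ _ _)).
rewrite (pre2 (rassoc_lassoc _ _ _)) id2_right.
rewrite -(vassocr _ (lassoc h r _)) -pentagon !vassocr.
rewrite (pre2 (eq_sym (lwhisker_vcomp _ _ _))) rassoc_lassoc lwhisker_id2.
rewrite id2_right (pre2 (rwhisker_lwhisker _ _ _)) vassocr.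
congr (_ • _ • _).
apply: (vcomp_rcancel (rwhisker_invertible k (lassoc_invertible _ _ _))).
rewrite (pre2 (eq_sym (rwhisker_vcomp _ _ _))) rassoc_lassoc rwhisker_id2.
rewrite id2_right -!(vassocr (rassoc _ _ _)) pentagon vassocr.
by rewrite rassoc_lassoc id2_left.
Qed.

Lemma rassoc_pentagon (s t u v w : B) (f : s --> t) (g : t --> u)
  (h : u --> v) (i : v --> w) :
  (rassoc f g h ▹ i) • rassoc f (g · h) i • (f ◃ rassoc g h i)
  = rassoc (f · g) h i • rassoc f g (h · i).
Proof.
have hinv : is_invertible ((f ◃ lassoc g h i) • lassoc f (g · h) i
    • (lassoc f g h ▹ i)).
  do !apply: vcomp_invertible; [ | exact: lassoc_invertible | ].
    exact/lwhisker_invertible/lassoc_invertible.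
  exact/rwhisker_invertible/lassoc_invertible.
apply: (vcomp_lcancel hinv); rewrite {2}pentagon !vassocr.
rewrite (pre2 (eq_sym (rwhisker_vcomp _ _ _))) lassoc_rassoc rwhisker_id2.
rewrite id2_right (pre2 (lassoc_rassoc _ _ _)) id2_right -lwhisker_vcomp.
rewrite lassoc_rassoc lwhisker_id2.
by rewrite (pre2 (lassoc_rassoc _ _ _)) id2_right lassoc_rassoc.
Qed.

Lemma pre5 (u v : B) (f0 f1 f2 f3 f4 f5 g : u --> v) (x1 : f0 ==> f1)
  (x2 : f1 ==> f2) (x3 : f2 ==> f3) (x4 : f3 ==> f4) (x5 : f4 ==> f5)
  (z : f0 ==> f5) :
  x1 • x2 • x3 • x4 • x5 = z ->
  forall k : g ==> f0, k • x1 • x2 • x3 • x4 • x5 = k • z.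
Proof. by move=> e k; rewrite -!vassocr -e -!vassocr. Qed.

Lemma comp_monad_hom_mult a b c (f : monad_hom a b) (g : monad_hom b c) :
  (monad_mult a ▹ f · g) • comp_cell f g
  = rassoc (monad_endo a) (monad_endo a) (f · g)
      • (monad_endo a ◃ comp_cell f g)
      • lassoc (monad_endo a) (f · g) (monad_endo c)
      • (comp_cell f g ▹ monad_endo c)
      • rassoc (f · g) (monad_endo c) (monad_endo c)
      • (f · g ◃ monad_mult c).
Proof.
rewrite /comp_cell !vassocr rwhisker_rwhisker.
rewrite (pre2 (eq_sym (rwhisker_vcomp _ _ _))) mhom_mult.
rewrite !rwhisker_vcomp !vassocr (pre2 (mid_whisker_rassoc _ _ _)) vassocr.
rewrite (pre2 (eq_sym (lwhisker_vcomp _ _ _))) mhom_mult.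
rewrite !lwhisker_vcomp !vassocr (pre2 (lwhisker_lwhisker _ _ _)) vassocr.
congr (_ • _).
rewrite (pre3 (rassoc_pentagon _ _ _ _)) vassocr.
rewrite (pre2 (rwhisker_rassoc _ _ _)) vassocr whisker_square.
rewrite (pre2 (eq_sym (lwhisker_rassoc _ _ _))) vassocr.
rewrite (pre5 (eq_sym (whisker_square _ _ _))) !vassocr.
rewrite (pre3 (pentagon _ _ _ _)) vassocr.
rewrite (pre2 (lwhisker_lwhisker _ _ _)) vassocr.
rewrite (pre2 (eq_sym (rwhisker_rwhisker _ _ _))) vassocr.
by rewrite (pre2 (eq_sym (vcomp_whisker _ _))) vassocr.
Qed.

Definition comp_monad_hom a b c (f : monad_hom a b) (g : monad_hom b c) :
    monad_hom a c :=
  @MonadHom B a c (f · g) (comp_cell f g) (comp_cell_invertible f g)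
    (comp_monad_hom_unit f g) (comp_monad_hom_mult f g).

Lemma id_monad_cell_law a b (f : monad_hom a b) :
  mhom_cell f • (id2 f ▹ monad_endo b) = (monad_endo a ◃ id2 f) • mhom_cell f.
Proof. by rewrite rwhisker_id2 lwhisker_id2 id2_left id2_right. Qed.

Definition id_monad_cell a b (f : monad_hom a b) : monad_cell f f :=
  MonadCell (id_monad_cell_law f).

Lemma vcomp_monad_cell_law a b (f g h : monad_hom a b)
  (x : monad_cell f g) (y : monad_cell g h) :
  mhom_cell f • ((x • y) ▹ monad_endo b)
  = (monad_endo a ◃ (x • y)) • mhom_cell h.
Proof.
rewrite rwhisker_vcomp lwhisker_vcomp vassocr mcell_law.
by rewrite -vassocr mcell_law vassocr.
Qed.

Definition vcomp_monad_cell a b (f g h : monad_hom a b)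
    (x : monad_cell f g) (y : monad_cell g h) : monad_cell f h :=
  MonadCell (vcomp_monad_cell_law x y).

Lemma lwhisker_monad_cell_law a b c (f : monad_hom a b) (g h : monad_hom b c)
  (x : monad_cell g h) :
  comp_cell f g • ((f ◃ x) ▹ monad_endo c)
  = (monad_endo a ◃ (f ◃ x)) • comp_cell f h.
Proof.
rewrite /comp_cell !vassocr (pre2 (eq_sym (rwhisker_lwhisker _ _ _))) vassocr.
rewrite (pre2 (eq_sym (lwhisker_vcomp _ _ _))) mcell_law lwhisker_vcomp.
rewrite vassocr (pre2 (eq_sym (lwhisker_rassoc _ _ _))) vassocr.
by rewrite (pre2 (vcomp_whisker _ _)) vassocr lwhisker_lwhisker.
Qed.

Definition lwhisker_monad_cell a b c (f : monad_hom a b)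
    (g h : monad_hom b c) (x : monad_cell g h) :
    monad_cell (comp_monad_hom f g) (comp_monad_hom f h) :=
  @MonadCell B a c (comp_monad_hom f g) (comp_monad_hom f h) (f ◃ x)
    (lwhisker_monad_cell_law f x).

Lemma rwhisker_monad_cell_law a b c (f g : monad_hom a b) (h : monad_hom b c)
  (x : monad_cell f g) :
  comp_cell f h • ((x ▹ h) ▹ monad_endo c)
  = (monad_endo a ◃ (x ▹ h)) • comp_cell g h.
Proof.
rewrite /comp_cell !vassocr rwhisker_lwhisker.
rewrite (pre2 (eq_sym (rwhisker_vcomp _ _ _))) -mcell_law rwhisker_vcomp.
rewrite vassocr (pre2 (rwhisker_rassoc _ _ _)) vassocr.
rewrite (pre2 (vcomp_whisker _ _)) vassocr.
by rewrite (pre2 (rwhisker_rwhisker _ _ _)) vassocr.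
Qed.

Definition rwhisker_monad_cell a b c (f g : monad_hom a b)
    (h : monad_hom b c) (x : monad_cell f g) :
    monad_cell (comp_monad_hom f h) (comp_monad_hom g h) :=
  @MonadCell B a c (comp_monad_hom f h) (comp_monad_hom g h) (x ▹ h)
    (rwhisker_monad_cell_law h x).

Lemma inverse_monad_cell_law a b (f g : monad_hom a b) (x : monad_cell f g)
  (hx : is_invertible (mcell x)) :
  mhom_cell g • (inv_cell hx ▹ monad_endo b)
  = (monad_endo a ◃ inv_cell hx) • mhom_cell f.
Proof.
apply: (vcomp_lcancel (lwhisker_invertible (monad_endo a) hx)).
rewrite !vassocr -mcell_law -lwhisker_vcomp -vassocr -rwhisker_vcomp.
by rewrite !inv_cell_right lwhisker_id2 rwhisker_id2 id2_left id2_right.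
Qed.

Definition inverse_monad_cell a b (f g : monad_hom a b) (x : monad_cell f g)
    (hx : is_invertible (mcell x)) : monad_cell g f :=
  MonadCell (inverse_monad_cell_law hx).

Lemma lunitor_monad_cell_law a b (f : monad_hom a b) :
  comp_cell (id_monad_hom a) f • (lunitor f ▹ monad_endo b)
  = (monad_endo a ◃ lunitor f) • mhom_cell f.
Proof.
rewrite /comp_cell /= (pre2 (lunitor_triangle _ _)).
rewrite (pre2 (lunitor_natural _)) vassocr (pre2 (rassoc_lunitor _ _)).
rewrite rwhisker_vcomp vassocr (pre2 (eq_sym (rwhisker_vcomp _ _ _))).
by rewrite linvunitor_lunitor rwhisker_id2 id2_right triangle.
Qed.

Definition lunitor_monad_cell a b (f : monad_hom a b) :
    monad_cell (comp_monad_hom (id_monad_hom a) f) f :=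
  @MonadCell B a b (comp_monad_hom (id_monad_hom a) f) f (lunitor f)
    (lunitor_monad_cell_law f).

Lemma runitor_monad_cell_law a b (f : monad_hom a b) :
  comp_cell f (id_monad_hom b) • (runitor f ▹ monad_endo b)
  = (monad_endo a ◃ runitor f) • mhom_cell f.
Proof.
rewrite /comp_cell /= lwhisker_vcomp !vassocr.
rewrite (pre3 (linvunitor_triangle _ _)) id2_right.
rewrite (pre2 (rassoc_runitor _ _)) (pre2 (runitor_natural _)) vassocr.
by rewrite runitor_triangle.
Qed.

Definition runitor_monad_cell a b (f : monad_hom a b) :
    monad_cell (comp_monad_hom f (id_monad_hom b)) f :=
  @MonadCell B a b (comp_monad_hom f (id_monad_hom b)) f (runitor f)
    (runitor_monad_cell_law f).

Lemma lassoc_monad_cell_law a b c d (f : monad_hom a b) (g : monad_hom b c)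
  (h : monad_hom c d) :
  comp_cell f (comp_monad_hom g h) • (lassoc f g h ▹ monad_endo d)
  = (monad_endo a ◃ lassoc f g h) • comp_cell (comp_monad_hom f g) h.
Proof.
rewrite /comp_cell /= /comp_cell !lwhisker_vcomp !rwhisker_vcomp !vassocr.
rewrite (pre3 (pentagon _ _ _ _)) vassocr.
rewrite (pre2 (lwhisker_lwhisker _ _ _)) vassocr pentagon.
rewrite (pre2 (eq_sym (rwhisker_rwhisker _ _ _))) vassocr.
by rewrite (pre5 (whisker_square _ _ _)) !vassocr.
Qed.

Definition lassoc_monad_cell a b c d (f : monad_hom a b) (g : monad_hom b c)
    (h : monad_hom c d) :
    monad_cell (comp_monad_hom f (comp_monad_hom g h))
      (comp_monad_hom (comp_monad_hom f g) h) :=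
  @MonadCell B a d (comp_monad_hom f (comp_monad_hom g h))
    (comp_monad_hom (comp_monad_hom f g) h) (lassoc f g h)
    (lassoc_monad_cell_law f g h).

Definition linvunitor_monad_cell a b (f : monad_hom a b) :
    monad_cell f (comp_monad_hom (id_monad_hom a) f) :=
  @inverse_monad_cell a b _ _ (lunitor_monad_cell f) (lunitor_invertible f).

Definition rinvunitor_monad_cell a b (f : monad_hom a b) :
    monad_cell f (comp_monad_hom f (id_monad_hom b)) :=
  @inverse_monad_cell a b _ _ (runitor_monad_cell f) (runitor_invertible f).

Definition rassoc_monad_cell a b c d (f : monad_hom a b) (g : monad_hom b c)
    (h : monad_hom c d) :
    monad_cell (comp_monad_hom (comp_monad_hom f g) h)
      (comp_monad_hom f (comp_monad_hom g h)) :=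
  @inverse_monad_cell a d _ _ (lassoc_monad_cell f g h)
    (lassoc_invertible f g h).

Definition monad_bicat_data : bicat_data :=
  @BicatData (monad B) (@monad_hom B) (@monad_cell B)
    id_monad_hom comp_monad_hom
    id_monad_cell vcomp_monad_cell lwhisker_monad_cell
    (fun a b c f g h x => @rwhisker_monad_cell a b c f g h x)
    lunitor_monad_cell linvunitor_monad_cell
    runitor_monad_cell rinvunitor_monad_cell
    lassoc_monad_cell rassoc_monad_cell.

Lemma monad_bicat_laws : bicat_laws monad_bicat_data.
Proof.
split=> *; apply: monad_cell_eq.
- exact: id2_left.
- exact: id2_right.
- exact: vassocr.
- exact: lwhisker_id2.
- exact: rwhisker_id2.
- exact: lwhisker_vcomp.
- exact: rwhisker_vcomp.
- exact: lunitor_natural.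
- exact: runitor_natural.
- exact: lwhisker_lwhisker.
- exact: rwhisker_lwhisker.
- exact: rwhisker_rwhisker.
- exact: vcomp_whisker.
- exact: lunitor_linvunitor.
- exact: linvunitor_lunitor.
- exact: runitor_rinvunitor.
- exact: rinvunitor_runitor.
- exact: lassoc_rassoc.
- exact: rassoc_lassoc.
- exact: triangle.
- exact: pentagon.
Qed.

Definition monad_bicat : bicat := Bicat monad_bicat_laws monad_cell_isaset.

End MonadBicat.

(* Main.v *)
From Corelib Require Import ssreflect.
Require Import Defs.

(* Univalence is used in the form of path induction: the map [x = y -> R y] is an
   equivalence for all [y] exactly when every [(y, u)] in the total space of [R]
   equals [(x, r x eq_refl)].  Locally, induct on the 2-cell of [B] underlying an
   invertible 2-cell of monad morphisms.  Globally, induct on the underlying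
   adjoint equivalence of [B]: the left adjoint then lies over [id1], and its
   structure cell is an invertible 2-cell between the endomorphisms.  Induction
   on that 2-cell turns the left adjoint into the identity, and local univalence
   of the bicategory of monads makes an adjoint equivalence with identity left
   adjoint trivial. *)

Set Implicit Arguments.
Unset Strict Implicit.

Local Open Scope bicat_scope.

(** * Identity types *)

(** By path induction, each [r : c = v] equals a path built from [h] alone. *)
Lemma contr_path_isprop (C : Type) (c : C) (h : forall w, c = w) (w : C)
  (p q : c = w) : p = q.
Proof.
have h_eq (v : C) (r : c = v) : r = eq_trans (eq_sym (h c)) (h v).
  by case: v / r; rewrite eq_trans_sym_inv_l.
by rewrite (h_eq _ p) (h_eq _ q).
Qed.

(* The fibre of [r y] over [u] is a retract of the identity type
   [(x, r x eq_refl) = (y, u)] in the total space. *)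
Lemma isequiv_of_contr_total (A : Type) (x : A) (R : A -> Type)
  (r : forall y, x = y -> R y) :
  (forall y (u : R y), existT R x (r x eq_refl) = existT R y u) ->
  forall y, isequiv (r y).
Proof.
move=> h y u.
pose c := existT R x (r x eq_refl).
have hc : forall w, c = w by case.
pose fib (w : {y & R y}) := {s : x = projT1 w & r _ s = projT2 w}.
pose to_fib w (p : c = w) : fib w :=
  match p with eq_refl => existT _ eq_refl eq_refl end.
have fib_retract w (v : fib w) : {p : c = w | to_fib w p = v}.
  case: w v => z t; rewrite /fib /= => -[s e]; case: t / e; case: z / s.
  by exists eq_refl.
exists (to_fib (existT R y u) (hc _)) => v.
case: (fib_retract (existT R y u) v) => p <-.
by rewrite (contr_path_isprop hc p (hc _)).
Qed.

Lemma isequiv_path_ind (A : Type) (x : A) (R : A -> Type)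
  (r : forall y, x = y -> R y) (hr : forall y, isequiv (r y))
  (P : forall y, R y -> Prop) :
  P x (r x eq_refl) -> forall y (u : R y), P y u.
Proof.
by move=> Px y u; case: (hr y u) => -[s e] _; rewrite -e; case: y / s {u e}.
Qed.

(** * Equality of invertible 2-cells and of adjoint equivalences *)

Section Bicat.
Variable C : bicat.
Implicit Types a b : C.

Lemma is_invertible_isprop a b (f g : a --> b) (x : f ==> g)
  (h k : is_invertible x) : h = k.
Proof.
case: h k => [y y1 y2] [z z1 z2].
have e : y = z.
  by rewrite -(id2_left z) -y2 -vassocr z1 id2_right.
case: z / e z1 z2 => z1 z2.
by rewrite (cell_isaset y1 z1) (cell_isaset y2 z2).
Qed.

Lemma inv2cell_eq a b (f g : a --> b) (x y : inv2cell f g) :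
  inv2cell_cell x = inv2cell_cell y -> x = y.
Proof.
case: x y => [x hx] [y hy] /= e; case: y / e hy => hy.
by rewrite (is_invertible_isprop hx hy).
Qed.

Lemma inv2cell_ind (lu : locally_univalent C) a b (f : a --> b)
  (P : forall g, inv2cell f g -> Prop) :
  P f (id_inv2cell f) -> forall g (x : inv2cell f g), P g x.
Proof. exact: (isequiv_path_ind (lu a b f)). Qed.

Lemma adj_equiv_ind (gu : globally_univalent C) a
  (P : forall b, adj_equiv a b -> Prop) :
  P a (id_adj_equiv a) -> forall b (u : adj_equiv a b), P b u.
Proof. exact: (isequiv_path_ind (gu a)). Qed.

(* By local univalence the invertible 2-cell
   [id1 a ==> id1 a · ae_right u ==> ae_right u] is an identity, which fixes the
   right adjoint and the unit; the first triangle then fixes the counit. *)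
Lemma adj_equiv_id1_unique (lu : locally_univalent C) a (u : adj_equiv a a) :
  id1 a = ae_left u -> u = id_adj_equiv a.
Proof.
case: u => f g eta eps t1 t2 /= e.
case: f / e eta eps t1 t2 => eta.
pose x := Inv2cell (vcomp_invertible (inv2cell_invertible eta)
                      (lunitor_invertible g)).
(* Induction needs [x] to be a variable; the equation keeps its link to [eta]. *)
move: x (eq_refl : inv2cell_cell x = eta • lunitor g) => x.
elim/(inv2cell_ind lu): g / x eta => eta /= eta_lunitor eps t1 t2.
have e : eta = Inv2cell (linvunitor_invertible (id1 a)).
  apply: inv2cell_eq; apply: (vcomp_rcancel (lunitor_invertible _)).
  by rewrite -eta_lunitor /= linvunitor_lunitor.
move: t1 t2; rewrite {}e {eta eta_lunitor} => t1 t2.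
have e : eps = Inv2cell (lunitor_invertible (id1 a)).
  apply: inv2cell_eq; apply: id_lwhisker_inj.
  apply: (vcomp_rcancel (runitor_invertible _)).
  have hinv : is_invertible (linvunitor (id1 a)
      • (linvunitor (id1 a) ▹ id1 a) • rassoc (id1 a) (id1 a) (id1 a)).
    do !apply: vcomp_invertible; [exact: linvunitor_invertible| |].
      exact/rwhisker_invertible/linvunitor_invertible.
    exact: rassoc_invertible.
  by apply: (vcomp_lcancel hinv); rewrite !vassocr t1 id_triangle_left.
move: t1 t2; rewrite {}e => t1 t2.
rewrite /id_adj_equiv.
by rewrite (cell_isaset t1 (id_triangle_left a))
           (cell_isaset t2 (id_triangle_right a)).
Qed.

End Bicat.

(** * Univalence of the bicategory of monads *)

Section Monads.
Variable B : bicat.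
Implicit Types a b : monad B.

(** Invertibility and the two laws are propositions, as 2-cells form sets. *)
Lemma monad_hom_eq a b (f : a --> b) n hn u m n' hn' u' m' :
  n = n' -> @MonadHom B a b f n hn u m = @MonadHom B a b f n' hn' u' m'.
Proof.
move=> e; case: n' / e hn' u' m' => hn' u' m'.
rewrite (is_invertible_isprop hn hn').
by rewrite (cell_isaset u u') (cell_isaset m m').
Qed.

Lemma monad_inv2cell_eq a b (f g : monad_hom a b)
  (x y : @inv2cell (monad_bicat B) a b f g) :
  mcell (inv2cell_cell x) = mcell (inv2cell_cell y) -> x = y.
Proof. by move=> e; apply/inv2cell_eq/monad_cell_eq. Qed.

Definition underlying_inv2cell a b (f g : monad_hom a b)
    (x : @inv2cell (monad_bicat B) a b f g) : inv2cell (mhom f) (mhom g) :=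
  Inv2cell (IsInvertible
    (f_equal (@mcell B a b f f) (inv_cell_right (inv2cell_invertible x)))
    (f_equal (@mcell B a b g g) (inv_cell_left (inv2cell_invertible x)))).

Definition underlying_adj_equiv a b
    (u : @adj_equiv (monad_bicat B) a b) : adj_equiv (a : B) (b : B) :=
  @AdjEquiv B a b (mhom (ae_left u)) (mhom (ae_right u))
    (underlying_inv2cell (ae_unit u)) (underlying_inv2cell (ae_counit u))
    (f_equal (@mcell B a b _ _) (ae_triangle_left u))
    (f_equal (@mcell B b a _ _) (ae_triangle_right u)).

Lemma monad_locally_univalent :
  locally_univalent B -> locally_univalent (monad_bicat B).
Proof.
move=> lu a b f; apply: isequiv_of_contr_total => g x.
case: f g x => f0 nf hnf uf mf g x.
(* Induction runs on a 2-cell of [B], so the monad structure over [g0] is generalised. *)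
suff main g0 (x0 : inv2cell f0 g0) : forall n hn u m
    (y : @inv2cell (monad_bicat B) a b (@MonadHom B a b f0 nf hnf uf mf)
           (@MonadHom B a b g0 n hn u m)),
    mcell (inv2cell_cell y) = inv2cell_cell x0 ->
    existT (@inv2cell (monad_bicat B) a b (@MonadHom B a b f0 nf hnf uf mf))
      _ (@id_inv2cell (monad_bicat B) a b _) = existT _ _ y.
  by case: g x => g0 n hn u m x; apply: (main g0 (underlying_inv2cell x)).
elim/(inv2cell_ind lu): g0 / x0 => n hn u m y /= y_id.
have e : nf = n.
  have := mcell_law (inv2cell_cell y).
  by rewrite y_id /= lwhisker_id2 rwhisker_id2 id2_left id2_right.
case: n / e hn u m y y_id => hn u m.
rewrite -(is_invertible_isprop hnf hn) -(cell_isaset uf u).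
rewrite -(cell_isaset mf m) => y y_id.
by congr existT; apply: monad_inv2cell_eq.
Qed.

(* A monad structure on [a] together with a monad morphism over [id1 a] amounts,
   through the unitors, to an invertible 2-cell between the endomorphisms
   compatible with units and multiplications. *)
Lemma monad_hom_id1_path (lu : locally_univalent B) a (t : (a : B) --> a)
  eta mu ur ul ma n hn hu hm (b := @Monad B a t eta mu ur ul ma) :
  existT (@monad_hom B a) a (id_monad_hom a)
  = existT _ b (@MonadHom B a b (id1 (a : B)) n hn hu hm).
Proof.
rewrite {}/b.
pose x := Inv2cell (vcomp_invertible (vcomp_invertible
  (inverse_invertible (runitor_invertible (monad_endo a))) hn)
  (lunitor_invertible t)).
(* Once [x] is the identity, this makes [n] the structure cell of [id_monad_hom a]. *)
have : runitor (monad_endo a) • x • linvunitor t = n.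
  rewrite /= !vassocr runitor_rinvunitor id2_left.
  by rewrite -vassocr lunitor_linvunitor id2_right.
move: x => x; elim/(inv2cell_ind lu): t / x eta mu ur ul ma n hn hu hm.
move=> eta mu ur ul ma n hn hu hm /=; rewrite id2_right => e.
case: n / e hn hu hm => hn hu hm.
(* The unit laws of the two morphisms now have equal left sides. *)
have e : monad_unit a = eta.
  apply: id_lwhisker_inj.
  apply: (vcomp_lcancel (vcomp_invertible (lunitor_invertible _)
    (inverse_invertible (runitor_invertible _)))).
  by rewrite -[RHS]hu -id_monad_hom_unit.
case: eta / e ur ul ma hn hu hm => ur ul ma hn hu hm.
have e : monad_mult a = mu.
  apply: id_lwhisker_inj; move: hm; rewrite id_monad_hom_mult /= => hm.
  apply: vcomp_lcancel hm.
  have hid := mhom_cell_invertible (id_monad_hom a).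
  do 4?[apply: vcomp_invertible];
    [exact: rassoc_invertible | exact: lwhisker_invertible hid
    | exact: lassoc_invertible | exact: rwhisker_invertible hid
    | exact: rassoc_invertible].
case: mu / e ur ul ma hn hu hm => ur ul ma hn hu hm.
have -> : id_monad_hom a = @MonadHom B a a (id1 (a : B)) _ hn hu hm.
  exact: monad_hom_eq.
case: a ur ul ma hn hu hm => a0 t eta mu ur' ul' ma' /= ur ul ma.
by rewrite (cell_isaset ur' ur) (cell_isaset ul' ul) (cell_isaset ma' ma).
Qed.

Lemma monad_hom_adj_equiv_path (ub : is_univalent B) a b (f : monad_hom a b)
  (v : adj_equiv (a : B) (b : B)) :
  ae_left v = mhom f ->
  existT (@monad_hom B a) a (id_monad_hom a) = existT _ b f.
Proof.
case: ub => lu gu.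
case: b f v => b0 t eta mu ur ul ma [f0 n hn hu hm] /= v e.
case: f0 / e n hn hu hm.
elim/(adj_equiv_ind gu): b0 / v t eta mu ur ul ma => t eta mu ur ul ma.
exact: monad_hom_id1_path.
Qed.

Lemma monad_globally_univalent :
  is_univalent B -> globally_univalent (monad_bicat B).
Proof.
move=> ub a; apply: isequiv_of_contr_total => b u.
have := monad_hom_adj_equiv_path ub (v := underlying_adj_equiv u) eq_refl.
(* With the pair abstracted to [w], path induction turns the left adjoint into the identity. *)
suff main (w : {b & monad_hom a b}) :
    existT (@monad_hom B a) a (id_monad_hom a) = w ->
    forall u : @adj_equiv (monad_bicat B) a (projT1 w), projT2 w = ae_left u ->
    existT (@adj_equiv (monad_bicat B) a) a
      (@id_adj_equiv (monad_bicat B) a) = existT _ (projT1 w) u.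
  by move=> e; apply: (main _ e).
move=> ew; case: w / ew => u' e /=; congr existT; apply: eq_sym.
apply: (@adj_equiv_id1_unique (monad_bicat B) _ a u' e).
exact: (monad_locally_univalent (fst ub)).
Qed.

End Monads.

Theorem theorem9p14 (B : bicat) :
  is_univalent B -> is_univalent (monad_bicat B).
Proof.
move=> ub; split; last exact: monad_globally_univalent.
exact: (monad_locally_univalent (fst ub)).
Qed.
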